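(* Let $\alpha>-1$ be a real number, and put $\lambda_k=k^\alpha$ for $k\ge1$ and $\Lambda_n=\sum_{i=1}^n\lambda_i$ for $n\ge 1$. Then for every convergent infinite series $\sum a_n$ with non-negative terms, $$\sum_{n=1}^\infty\Big(\prod_{k=1}^n a_k^{\lambda_k/\Lambda_n}\Big)\le e^{1/(\alpha+1)}\sum_{n=1}^\infty a_n.$$ *)

(* Defs.v *)
From mathcomp Require Import all_boot all_order all_algebra.
From mathcomp Require Import all_classical all_reals all_analysis.

Set Implicit Arguments.
Unset Strict Implicit.
Unset Printing Implicit Defensive.

Import Order.TTheory GRing.Theory Num.Theory.
Import numFieldNormedType.Exports.

Local Open Scope classical_set_scope.
Local Open Scope ring_scope.

Section WeightedGeometricMean.
Context {R : realType}.
Implicit Types (alpha : R) (a : R^nat) (k n : nat).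

(* Sequences are indexed from 1; values at index 0 are never used. *)
Definition weight alpha k : R := k%:R `^ alpha.

Definition weight_sum alpha n : R := \sum_(1 <= i < n.+1) weight alpha i.

(* For x > 0, powR satisfies 0 `^ x = 0, so a mean with a zero entry is 0. *)
Definition weighted_gmean alpha a n : R :=
  \prod_(1 <= k < n.+1) a k `^ (weight alpha k / weight_sum alpha n).

Definition series1 a : R^nat := fun N => \sum_(1 <= n < N.+1) a n.

End WeightedGeometricMean.

(* Main.v *)
Require Import Defs.
From mathcomp Require Import all_boot all_order all_algebra.
From mathcomp Require Import all_classical all_reals all_analysis.
From mathcomp Require Import ring lra.

Set Implicit Arguments.
Unset Strict Implicit.
Unset Printing Implicit Defensive.

Import Order.TTheory GRing.Theory Num.Theory.
Import numFieldNormedType.Exports.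

Local Open Scope classical_set_scope.
Local Open Scope ring_scope.

(** Put [p = alpha + 1], [r_n = Lambda_n / lambda_n], [C = e^(1/p)] and let [G_n]
    be the n-th weighted geometric mean, so that
    [G_(n+1) = G_n^(1 - 1/r_(n+1)) a_(n+1)^(1/r_(n+1))].  Induction on N gives
      [G_1 + ... + G_N + (r_(N+1) - 1) G_N <= C (a_1 + ... + a_N)]:
    by AM-GM with weights [1 - 1/r] and [1/r], where [r = r_(N+1)],
      [(r - 1) G_N + C a_(N+1) >= r C^(1/r) G_(N+1)],
    and the induction closes as soon as [r_(n+1) <= r_n e^(1/(p r_n))].
    That growth estimate follows from [r_(n+1) - r_n <= 1/p] when [alpha <= 0] or
    [alpha >= 1].  For [0 < alpha < 1] the increments may exceed [1/p], by less than
    what the quadratic term of the exponential provides. *)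

(** * Bernoulli-type and exponential inequalities *)

Lemma ge0_derive_le (R : realType) (f f' : R -> R) (h : R) :
  0 <= h -> (forall x, 0 <= x <= h -> is_derive x 1 f (f' x)) ->
  (forall x, 0 <= x <= h -> 0 <= f' x) -> f 0 <= f h.
Proof.
move=> h0 df f'0.
have inh x : x \in `]0, h[%R -> 0 <= x <= h.
  by rewrite in_itv/= => /andP[x0 xh]; rewrite !ltW.
apply: (@ger0_derive1_ndecr _ f 0 h) => // [x /inh xh|x /inh xh|].
- by have [] := df _ xh.
- by rewrite derive1E (@derive_val _ _ _ _ _ _ _ (df _ xh)) f'0.
- apply: derivable_within_continuous => x; rewrite in_itv/= => xh.
  by have [] := df _ xh.
Qed.

Lemma weighted_amgm2 (R : realType) (q x y : R) : 0 <= q <= 1 -> 0 <= x -> 0 <= y ->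
  x `^ (1 - q) * y `^ q <= (1 - q) * x + q * y.
Proof.
move=> /andP[q0 q1] x0 y0.
(* Young's inequality is applied with the conjugate exponents [1/(1-q)] and [1/q], so the endpoints
   are treated apart. *)
have [->|qn0] := eqVneq q 0; first by rewrite subr0 powRr1// powRr0; lra.
have [->|qn1] := eqVneq q 1; first by rewrite subrr powRr1// powRr0; lra.
have q1' : 0 < 1 - q by rewrite subr_gt0 lt_neqAle qn1.
have q0' : 0 < q by rewrite lt_neqAle eq_sym qn0.
have := @conjugate_powR R (x `^ (1 - q)) (y `^ q) (1 - q)^-1 q^-1.
rewrite -!powRrM !mulfV ?gt_eqF// !powRr1// !invrK => /(_ _ _ _ _ _)/le_trans.
apply; rewrite ?powR_ge0 ?invr_gt0//; last by lra.
by rewrite subrK.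
Qed.

Lemma bernoulli_le (R : realType) (b x : R) : 0 <= b <= 1 -> - 1 <= x ->
  (1 + x) `^ b <= 1 + b * x.
Proof.
move=> b01 x1; have := @weighted_amgm2 R b 1 (1 + x) b01 ler01.
by rewrite powR1 mul1r => /(_ _)/le_trans; apply; lra.
Qed.

(** Apply [bernoulli_le] with exponent [1/b] to [b * x], then raise both sides to the power [b]. *)
Lemma bernoulli_ge1 (R : realType) (b x : R) : 1 <= b -> 0 <= x ->
  1 + b * x <= (1 + x) `^ b.
Proof.
move=> b1 x0; have b0 : 0 < b by lra.
have bx0 : 0 <= b * x by rewrite mulr_ge0// ltW.
have h : (1 + b * x) `^ b^-1 <= 1 + x.
  have := @bernoulli_le R b^-1 (b * x); rewrite mulKf ?gt_eqF//; apply; last by lra.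
  by rewrite invr_ge0 ltW//= invf_le1.
have := @ge0_ler_powR R b (ltW b0) _ _ _ _ h.
rewrite -powRrM mulVf ?gt_eqF// powRr1; last by lra.
by apply; rewrite nnegrE ?powR_ge0//; lra.
Qed.

Lemma bernoulli_neg (R : realType) (b x : R) : b <= 0 -> - 1 < x ->
  1 + b * x <= (1 + x) `^ b.
Proof.
move=> b0 x1; rewrite /powR gt_eqF; last by lra.
apply: le_trans (expR_ge1Dx _).
by rewrite lerD2l ler_wnM2l// le_ln1Dx.
Qed.

Lemma is_derive_mull (R : realType) (c x : R) : is_derive x 1 (fun y : R => c * y) c.
Proof.
have d := is_deriveZ c (is_derive_id x (1 : R)).
by move: d; rewrite /GRing.scale /= mulr1.
Qed.

Lemma is_derive_powR_affine (R : realType) (c r x : R) : 0 < 1 + c * x ->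
  is_derive x 1 (fun y : R => (1 + c * y) `^ r) (r * (1 + c * x) `^ (r - 1) * c).
Proof.
move=> x1.
have da := is_deriveD (is_derive_cst (1 : R) x 1) (is_derive_mull c x).
rewrite add0r in da.
exact: (@is_derive1_comp _ _ _ x _ _ (is_derive1_powR r x1) da).
Qed.

(** Both sides vanish at [h = 0]. The derivative of the difference is
    [s ((1-x)^(-s-1) + (1+x)^(-s-1) - 2)], and the Bernoulli lower bounds [1 + (s+1)x] and
    [1 - (s+1)x] of the two powers add up to 2. *)
Lemma powR_opp_diff_ge (R : realType) (s h : R) : 0 <= s -> 0 <= h < 1 ->
  2 * s * h <= (1 + - 1 * h) `^ (- s) - (1 + 1 * h) `^ (- s).
Proof.
move=> s0 /andP[h0 h1].
pose f (x : R) := ((1 + - 1 * x) `^ (- s) - (1 + 1 * x) `^ (- s)) + (- (2 * s)) * x.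
pose f' (x : R) := (- s * (1 + - 1 * x) `^ (- s - 1) * (- 1) -
  - s * (1 + 1 * x) `^ (- s - 1) * 1) + (- (2 * s)).
suff: f 0 <= f h by rewrite /f !mulr0 addr0 subrr; lra.
apply: (@ge0_derive_le _ f f') => [|x /andP[x0 xh]|x /andP[x0 xh]]; first exact: h0.
- have d1 := @is_derive_powR_affine R (- 1) (- s) x ltac:(lra).
  have d2 := @is_derive_powR_affine R 1 (- s) x ltac:(lra).
  exact: (is_deriveD (is_deriveB d1 d2) (is_derive_mull (- (2 * s)) x)).
- have b1 := @bernoulli_neg R (- s - 1) (- 1 * x) ltac:(lra) ltac:(lra).
  have b2 := @bernoulli_neg R (- s - 1) (1 * x) ltac:(lra) ltac:(lra).
  rewrite /f'; nra.
Qed.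

(* With [U, V = (1 + x)^(r-1), (1 - x)^(r-1)], the derivative of the right-hand
   side is [r (U - V - 2 (r - 1) x U V)], nonnegative by [powR_opp_diff_ge]. *)
Lemma powR_sum_prod_ge (R : realType) (r h : R) : 1 <= r -> 0 <= h < 1 ->
  r + 1 <= (1 + h) `^ r + (1 - h) `^ r + (r - 1) * ((1 + h) `^ r * (1 - h) `^ r).
Proof.
move=> r1 /andP[h0 h1].
pose U (x : R) := (1 + 1 * x) `^ r; pose V (x : R) := (1 + - 1 * x) `^ r.
pose U' (x : R) := r * (1 + 1 * x) `^ (r - 1) * 1.
pose V' (x : R) := r * (1 + - 1 * x) `^ (r - 1) * (- 1).
pose f (x : R) := U x + V x + (r - 1) * (U x * V x).
pose f' (x : R) := U' x + V' x + (r - 1) * (U x * V' x + V x * U' x).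
suff: f 0 <= f h.
  rewrite /f /U /V !mulr0 !addr0 powR1 !mul1r mulN1r.
  by apply: le_trans; lra.
apply: (@ge0_derive_le _ f f') => [|x /andP[x0 xh]|x /andP[x0 xh]]; first exact: h0.
- have d1 : is_derive x 1 U (U' x) by apply: is_derive_powR_affine; lra.
  have d2 : is_derive x 1 V (V' x) by apply: is_derive_powR_affine; lra.
  exact: (is_deriveD (is_deriveD d1 d2) (is_deriveZ _ (is_deriveM d1 d2))).
- have d := @powR_opp_diff_ge R (r - 1) x ltac:(lra) ltac:(lra).
  rewrite !powRN in d.
  rewrite /f' /U /V /U' /V'.
  have p1 : 0 < 1 + 1 * x by lra.
  have p2 : 0 < 1 + - 1 * x by lra.
  have r0 : 0 < r by lra.
  rewrite -(mulr_powRB1 (ltW p1) r0) -(mulr_powRB1 (ltW p2) r0).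
  have u0 := powR_gt0 (r - 1) p1; have v0 := powR_gt0 (r - 1) p2.
  set u := (1 + 1 * x) `^ (r - 1) in d u0 *.
  set v := (1 + - 1 * x) `^ (r - 1) in d v0 *.
  have {}d : 2 * (r - 1) * x * (u * v) <= u - v.
    have -> : u - v = (v^-1 - u^-1) * (u * v) by field; rewrite !gt_eqF.
    by rewrite ler_pM2r ?mulr_gt0.
  rewrite [leRHS](_ : _ = r * (u - v - 2 * (r - 1) * x * (u * v))); last by ring.
  by rewrite mulr_ge0//; lra.
Qed.

(** Expand [(1 + x/5)^5 <= e^x]. The exponent 5 is the least one whose quadratic coefficient,
    [(k-1)/(2k)] for exponent [k], exceeds the maximum of [alpha - alpha^3] needed in
    [mean_ratioS_le]. *)
Lemma expR_ge_quadratic (R : realType) (x : R) : 0 <= x ->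
  1 + x + 2 / 5 * x ^+ 2 <= expR x.
Proof.
move=> x0; have -> : expR x = expR (x / 5) ^+ 5.
  by rewrite -expRM_natl; congr expR; field.
apply: le_trans (_ : (1 + x / 5) ^+ 5 <= _); last first.
  by rewrite lerXn2r ?nnegrE ?expR_ge0 ?expR_ge1Dx//; lra.
have x3 := exprn_ge0 3 x0; have x4 := exprn_ge0 4 x0; have x5 := exprn_ge0 5 x0.
have -> : (1 + x / 5) ^+ 5 = 1 + x + 2 / 5 * x ^+ 2 +
    (2 / 25 * x ^+ 3 + 1 / 125 * x ^+ 4 + 1 / 3125 * x ^+ 5) by field.
by rewrite lerDl; lra.
Qed.

(** * Growth of the ratios [r_n = Lambda_n / lambda_n] *)

Section MeanRatio.
Context {R : realType}.
Implicit Types (alpha : R) (k n : nat).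

Definition mean_ratio alpha n : R := weight_sum alpha n / weight alpha n.

Definition weight_ratio alpha n : R := weight alpha n / weight alpha n.+1.

Lemma weight_gt0 alpha k : (0 < k)%N -> 0 < weight alpha k.
Proof. by move=> k0; rewrite powR_gt0// ltr0n. Qed.

Lemma weight_sumS alpha n :
  weight_sum alpha n.+1 = weight_sum alpha n + weight alpha n.+1.
Proof. by rewrite /weight_sum big_nat_recr. Qed.

Lemma weight_sum_ge0 alpha n : 0 <= weight_sum alpha n.
Proof. by rewrite /weight_sum sumr_ge0// => i _; exact: powR_ge0. Qed.

Lemma weight_sum_gt0 alpha n : (0 < n)%N -> 0 < weight_sum alpha n.
Proof.
case: n => // n _.
by rewrite weight_sumS ltr_wpDl ?weight_sum_ge0// weight_gt0.
Qed.

Lemma mean_ratio_gt0 alpha n : (0 < n)%N -> 0 < mean_ratio alpha n.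
Proof. by move=> n0; rewrite divr_gt0 ?weight_sum_gt0 ?weight_gt0. Qed.

Lemma weight_ratio_gt0 alpha n : (0 < n)%N -> 0 < weight_ratio alpha n.
Proof. by move=> n0; rewrite divr_gt0 ?weight_gt0. Qed.

Lemma mean_ratioS alpha n : (0 < n)%N ->
  mean_ratio alpha n.+1 = 1 + mean_ratio alpha n * weight_ratio alpha n.
Proof.
move=> n0; rewrite /mean_ratio /weight_ratio weight_sumS.
by field; rewrite !gt_eqF ?weight_gt0.
Qed.

Lemma mean_ratio1 alpha : mean_ratio alpha 1 = 1.
Proof.
by rewrite /mean_ratio /weight_sum big_nat1 divff// gt_eqF ?weight_gt0.
Qed.

Lemma mean_ratio_ge1 alpha n : 1 <= mean_ratio alpha n.+1.
Proof.
rewrite /mean_ratio ler_pdivlMr ?weight_gt0// mul1r weight_sumS.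
by rewrite lerDr weight_sum_ge0.
Qed.

Lemma weight_ratioV alpha n : (0 < n)%N ->
  weight_ratio alpha n = ((1 + n%:R^-1) `^ alpha)^-1.
Proof.
move=> n0; have n0' : 0 < n%:R :> R by rewrite ltr0n.
rewrite /weight_ratio /weight (_ : n.+1%:R = n%:R * (1 + n%:R^-1)); last first.
  by rewrite -natr1; field; rewrite gt_eqF.
rewrite powRM ?ltW ?addr_gt0 ?invr_gt0//.
by rewrite invfM mulrA divff ?mul1r// gt_eqF ?powR_gt0.
Qed.

Lemma weight_ratioN alpha n : (0 < n)%N ->
  weight_ratio alpha n = (1 + n%:R^-1) `^ (- alpha).
Proof. by move=> n0; rewrite powRN weight_ratioV. Qed.

(** With base [1 - 1/(n+1)], [bernoulli_le] bounds the ratio from above when [0 <= alpha <= 1]; this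
    is also the factor [(1 - h)^alpha] of [powR_sum_prod_ge]. *)
Lemma weight_ratioB alpha n : (0 < n)%N ->
  weight_ratio alpha n = (1 - n.+1%:R^-1) `^ alpha.
Proof.
move=> n0; have n0' : 0 < n%:R :> R by rewrite ltr0n.
rewrite /weight_ratio /weight -powR_inv1 ?powR_ge0// powRAC powR_inv1//.
rewrite -powRM ?invr_ge0//; congr (_ `^ _).
by rewrite -natr1; field; rewrite gt_eqF// ltr_wpDr.
Qed.

Lemma weight_ratio_ge alpha n : 0 <= alpha <= 1 -> (0 < n)%N ->
  n%:R <= (n%:R + alpha) * weight_ratio alpha n.
Proof.
move=> a01 n0; have n0' : 0 < n%:R :> R by rewrite ltr0n.
have V0 : 0 < n%:R^-1 :> R by rewrite invr_gt0.
rewrite weight_ratioV// ler_pdivlMr ?powR_gt0 ?addr_gt0//.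
have := @bernoulli_le R alpha n%:R^-1 a01 ltac:(lra).
rewrite -(@ler_pM2l _ n%:R)// => /le_trans; apply.
by rewrite mulrDr mulr1 mulrCA divff ?mulr1// gt_eqF.
Qed.

Lemma weight_ratio_le alpha n : alpha <= 0 -> (0 < n)%N ->
  (n%:R + alpha) * weight_ratio alpha n <= n%:R.
Proof.
move=> a0 n0; have n0' : 0 < n%:R :> R by rewrite ltr0n.
have V0 : 0 < n%:R^-1 :> R by rewrite invr_gt0.
rewrite weight_ratioV// ler_pdivrMr ?powR_gt0 ?addr_gt0//.
have := @bernoulli_neg R alpha n%:R^-1 a0 ltac:(lra).
rewrite -(@ler_pM2l _ n%:R)//; apply: le_trans.
by rewrite mulrDr mulr1 mulrCA divff ?mulr1// gt_eqF.
Qed.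

(** The line [(n + alpha)/(alpha + 1)] equals [r_1] at [n = 1], and [weight_ratio_ge] says exactly
    that it is a subsolution of the recursion [mean_ratioS]. *)
Lemma mean_ratio_ge alpha n : 0 <= alpha <= 1 -> (0 < n)%N ->
  n%:R + alpha <= (alpha + 1) * mean_ratio alpha n.
Proof.
move=> a01; elim: n => // -[_ _|n IH _]; first by rewrite mean_ratio1; lra.
rewrite mean_ratioS// -(natr1 n.+1).
move: (IH isT) (@weight_ratio_gt0 alpha n.+1 isT) (@weight_ratio_ge alpha n.+1 a01 isT).
by set m := n.+1%:R; nra.
Qed.

Lemma mean_ratio_le alpha n : alpha <= 0 -> (0 < n)%N ->
  (alpha + 1) * mean_ratio alpha n <= n%:R + alpha.
Proof.
move=> a0; elim: n => // -[_ _|n IH _]; first by rewrite mean_ratio1; lra.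
rewrite mean_ratioS// -(natr1 n.+1).
move: (IH isT) (@weight_ratio_gt0 alpha n.+1 isT) (@weight_ratio_le alpha n.+1 a0 isT).
by set m := n.+1%:R; nra.
Qed.

Lemma mean_ratio_le_nat alpha n : 0 <= alpha -> (0 < n)%N ->
  mean_ratio alpha n <= n%:R.
Proof.
move=> a0; elim: n => // -[_ _|n IH _]; first by rewrite mean_ratio1.
rewrite mean_ratioS// -natr1 addrC lerD2r.
apply: le_trans (IH isT); apply: ler_piMr; first by rewrite ltW ?mean_ratio_gt0.
rewrite weight_ratioV// invf_le1 ?powR_gt0 ?addr_gt0 ?invr_gt0//.
have := @ler_powR _ (1 + n.+1%:R^-1 : R) _ _ _ a0.
by rewrite powRr0; apply; rewrite lerDl invr_ge0.
Qed.

(* By [mean_ratioS] this says that the increments of [mean_ratio] are at most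
   [1 / (alpha + 1)].  With [P = (1 + h)^alpha], [Q = (1 - h)^alpha] and
   [h = 1 / (n + 2)], the induction step amounts to
   [alpha + 1 <= P + Q + (alpha - 1) P Q]. *)
Lemma mean_ratio_weight_ratio_ge alpha n : 1 <= alpha -> (0 < n)%N ->
  alpha <= (alpha + 1) * (mean_ratio alpha n * (1 - weight_ratio alpha n)).
Proof.
move=> a1; elim: n => // -[_ _|n IH _].
  (* For [n = 1] the claim reduces to [1 + alpha <= 2^alpha]. *)
  rewrite mean_ratio1 mul1r weight_ratioV// invr1.
  have b := @bernoulli_ge1 R alpha 1 a1 ler01.
  have p0 : 0 < (1 + 1) `^ alpha :> R by rewrite powR_gt0.
  set P := _ `^ _ in b p0 *.
  have -> : (alpha + 1) * (1 - P^-1) = alpha + (P - (1 + alpha * 1)) / P.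
    by field; rewrite gt_eqF.
  by rewrite lerDl divr_ge0 ?subr_ge0// ltW.
have m0 : 0 < n.+2%:R^-1 :> R by rewrite invr_gt0 ltr0n.
have m1 : n.+2%:R^-1 < 1 :> R by rewrite invf_lt1 ?ltr0n// ltr1n.
have := @powR_sum_prod_ge R alpha n.+2%:R^-1 a1.
rewrite m1 ltW//= => /(_ isT).
rewrite -weight_ratioB//.
rewrite mean_ratioS// (@weight_ratioV _ n.+2)//.
have P1 : 1 < (1 + n.+2%:R^-1) `^ alpha :> R.
  by rewrite (lt_le_trans _ (bernoulli_ge1 a1 (ltW m0)))// ltrDl mulr_gt0//; lra.
have Q0 := @weight_ratio_gt0 alpha n.+1 isT.
move: (IH isT) (mean_ratio_gt0 alpha (isT : 0 < n.+1)%N).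
have [P eP] : {P : R | (1 + n.+2%:R^-1) `^ alpha = P} by eexists.
rewrite eP in P1 *; move: Q0.
move: (mean_ratio _ _) (weight_ratio _ _) => r Q Q0 {}IH r0 F.
have P0 : 0 < P by lra.
rewrite [leRHS](_ : _ = (alpha + 1) * (1 + r * Q) * (P - 1) / P); last first.
  by field; rewrite gt_eqF.
have Q1 : Q < 1.
  rewrite -subr_gt0 -(pmulr_rgt0 _ r0) -(@pmulr_rgt0 _ (alpha + 1)); last by lra.
  by apply: lt_le_trans IH; lra.
suff : alpha * P <= (alpha + 1) * (1 + r * Q) * (P - 1) by rewrite ler_pdivlMr.
(* After multiplication by [1 - Q > 0], [r] occurs only through [r (1 - Q)], which [IH] bounds from
   below; what remains is [F]. *)
suff : 0 <= (1 - Q) * ((alpha + 1) * (1 + r * Q) * (P - 1) - alpha * P).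
  by rewrite pmulr_rge0 ?subr_ge0// subr_gt0.
have : 0 <= (P - 1) * Q * ((alpha + 1) * (r * (1 - Q)) - alpha).
  by rewrite !mulr_ge0 ?subr_ge0// ltW.
nra.
Qed.

Lemma mean_ratio_incr_le alpha n : -1 < alpha -> (0 < n)%N ->
  (alpha + 1) * (mean_ratio alpha n.+1 - mean_ratio alpha n) <= 1 ->
  mean_ratio alpha n.+1 <=
  mean_ratio alpha n * expR ((alpha + 1)^-1 / mean_ratio alpha n).
Proof.
move=> a1 n0; have p0 : 0 < alpha + 1 by lra.
have := mean_ratio_gt0 alpha n0; set r := mean_ratio _ n => r0.
set r' := mean_ratio _ _; rewrite mulrC -ler_pdivlMr// div1r => d.
apply: le_trans (_ : r * (1 + (alpha + 1)^-1 / r) <= _).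
  by rewrite mulrDr mulr1 mulrCA divff ?gt_eqF// mulr1; lra.
by rewrite ler_pM2l// expR_ge1Dx.
Qed.

Lemma mean_ratioS_le alpha n : -1 < alpha -> (0 < n)%N ->
  mean_ratio alpha n.+1 <=
  mean_ratio alpha n * expR ((alpha + 1)^-1 / mean_ratio alpha n).
Proof.
move=> a1 n0; have n0' : 0 < n%:R :> R by rewrite ltr0n.
have r0 := mean_ratio_gt0 alpha n0.
have t0 := weight_ratio_gt0 alpha n0.
have [ale0|agt0] := leP alpha 0.
  apply: mean_ratio_incr_le => //; rewrite mean_ratioS//.
  have V0 : 0 < n%:R^-1 :> R by rewrite invr_gt0.
  have b := @bernoulli_le R (- alpha) n%:R^-1 ltac:(lra) ltac:(lra).
  rewrite -weight_ratioN// in b.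
  have le := mean_ratio_le ale0 n0.
  move: b le r0; set t := weight_ratio _ _; set r := mean_ratio _ _ => b le r0.
  have nV : n%:R * n%:R^-1 = 1 :> R by rewrite divff// gt_eqF.
  have b' : n%:R * (t - 1) <= - alpha.
    rewrite -(ler_pM2l n0') mulrDr [n%:R * (- alpha * _)]mulrCA nV !mulr1 in b.
    by rewrite mulrBr mulr1; lra.
  rewrite -(@ler_pM2l _ n%:R)//.
  (* Multiplied by [n], the goal then holds with slack [alpha^2]. *)
  have : (alpha + 1) * r * (n%:R * (t - 1)) <= (n%:R + alpha) * - alpha.
    apply: le_trans (_ : (alpha + 1) * r * - alpha <= _).
      by rewrite ler_wpM2l// mulr_ge0// ltW//; lra.
    by rewrite ler_wpM2r//; lra.
  nra.
have [alt1|age1] := ltP alpha 1; last first.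
  apply: mean_ratio_incr_le => //; rewrite mean_ratioS//.
  by have := mean_ratio_weight_ratio_ge age1 n0; nra.
have a01 : 0 <= alpha <= 1 by rewrite !ltW.
have rge := mean_ratio_ge a01 n0.
have rle := mean_ratio_le_nat (ltW agt0) n0.
have p0 : 0 < alpha + 1 by lra.
have b : (1 + n%:R) * weight_ratio alpha n <= n%:R + 1 - alpha.
  have m0 : 0 < n.+1%:R :> R by rewrite ltr0n.
  have V1 : - 1 <= - n.+1%:R^-1 :> R by rewrite lerN2 invf_le1// ler1n.
  have := bernoulli_le a01 V1.
  rewrite -weight_ratioB// -(ler_pM2l m0) [1 + n%:R]addrC natr1 => /le_trans; apply.
  by rewrite mulrDr mulr1 mulrN mulrN mulrCA divff ?mulr1// gt_eqF.
rewrite mean_ratioS//.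
move: r0 t0 rge rle b; move: (mean_ratio _ _) (weight_ratio _ _) => r t.
move=> r0 t0 rge rle b.
set x := (alpha + 1)^-1 / r.
have x0 : 0 <= x by rewrite divr_ge0 ?ltW// invr_gt0.
apply: le_trans (_ : r * (1 + x + 2 / 5 * x ^+ 2) <= _); last by rewrite ler_pM2l// expR_ge_quadratic.
have -> : r * (1 + x + 2 / 5 * x ^+ 2) =
    r + (alpha + 1)^-1 + 2 / 5 / ((alpha + 1) ^+ 2 * r).
  by rewrite /x; field; rewrite !gt_eqF.
(* The increment [1 - r (1 - t)] exceeds [1/(alpha+1)] by [(alpha - y)/(alpha+1)]. The quadratic
   term supplies [2/5 / ((alpha+1)^2 r)], so the goal becomes [defect]. *)
pose y := (alpha + 1) * r * (1 - t).
have y_ge : (alpha - y) * (n%:R + 1) <= alpha * (1 - alpha).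
  have : 0 <= alpha * ((alpha + 1) * r - (n%:R + alpha)).
    by rewrite mulr_ge0 ?subr_ge0// ltW.
  have : 0 <= (alpha + 1) * r * (n%:R + 1 - alpha - (1 + n%:R) * t).
    by rewrite !mulr_ge0 ?subr_ge0// ltW.
  rewrite /y; nra.
(* The maximum of [alpha - alpha^3] on [0, 1] is about 0.385, just below the
   constant 2/5 of [expR_ge_quadratic]; 4/7 is close to its maximizer. *)
have cubic : (alpha + 1) * (alpha * (1 - alpha)) <= 2 / 5.
  have : 0 <= (alpha - 4 / 7) ^+ 2 * (alpha + 8 / 7).
    by rewrite mulr_ge0 ?sqr_ge0//; lra.
  lra.
(* After multiplication by [n + 1], [y_ge] removes [y]; then [r <= n] and [cubic] give the bound
   [2n/5]. *)
have defect : (alpha + 1) * r * (alpha - y) <= 2 / 5.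
  have n1 : 0 < n%:R + 1 :> R by lra.
  rewrite -(ler_pM2r n1) -[_ * (alpha - y) * _]mulrA.
  apply: le_trans (_ : (alpha + 1) * r * (alpha * (1 - alpha)) <= _).
    by rewrite ler_wpM2l// mulr_ge0// ltW.
  apply: le_trans (_ : n%:R * (2 / 5) <= _); last by lra.
  rewrite [_ * r]mulrC -mulrA ler_pM// ?(ltW r0)//.
  by rewrite !mulr_ge0 ?subr_ge0// ltW.
have -> : 1 + r * t = r + (alpha + 1)^-1 +
    ((alpha + 1) * r * (alpha - y)) / ((alpha + 1) ^+ 2 * r).
  by rewrite /y; field; rewrite !gt_eqF.
by rewrite lerD2l ler_pM2r// invr_gt0 mulr_gt0// exprn_gt0.
Qed.

End MeanRatio.

(** * Recursion for the geometric means and summation *)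

Lemma prod_powR (R : realType) (m n : nat) (F : nat -> R) (x : R) :
  (forall k, (m <= k)%N -> 0 <= F k) ->
  (\prod_(m <= k < n) F k) `^ x = \prod_(m <= k < n) F k `^ x.
Proof.
move=> F0; have [nm|mn] := leqP n m; first by rewrite !big_geq// powR1.
rewrite -(subnKC (ltnW mn)); elim: (n - m)%N => [|d IH].
  by rewrite addn0 !big_geq// powR1.
rewrite addnS !big_nat_recr ?leq_addr//= powRM ?IH ?F0 ?leq_addr//.
by rewrite big_nat prodr_ge0// => k /andP[mk _]; exact: F0.
Qed.

Lemma series1S (R : realType) (a : R^nat) n :
  series1 a n.+1 = series1 a n + a n.+1.
Proof. by rewrite /series1 big_nat_recr. Qed.

Lemma weighted_gmean_ge0 (R : realType) (alpha : R) (a : R^nat) n :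
  0 <= weighted_gmean alpha a n.
Proof. by rewrite prodr_ge0// => k _; exact: powR_ge0. Qed.

(** Since [1 - 1/r_(n+1) = Lambda_n / Lambda_(n+1)], the outer power turns each exponent
    [lambda_k / Lambda_n] into [lambda_k / Lambda_(n+1)]. *)
Lemma weighted_gmeanS (R : realType) (alpha : R) (a : R^nat) n :
  weighted_gmean alpha a n.+1 =
  weighted_gmean alpha a n `^ (1 - (mean_ratio alpha n.+1)^-1) *
  a n.+1 `^ (mean_ratio alpha n.+1)^-1.
Proof.
rewrite /weighted_gmean big_nat_recr//=; congr (_ * _ `^ _); last first.
  by rewrite /mean_ratio invf_div.
rewrite prod_powR; last by move=> k k0; exact: powR_ge0.
apply: eq_big_nat => k /andP[k0 kn]; rewrite -powRrM; congr (_ `^ _).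
have S1 := @weight_sum_gt0 R alpha n (leq_trans k0 kn).
have S2 := @weight_sum_gt0 R alpha n.+1 isT.
rewrite /mean_ratio invf_div; move: S2; rewrite weight_sumS => S2.
by field; rewrite !gt_eqF.
Qed.

Lemma mean_ratio_gmeanS_le (R : realType) (alpha : R) (a : R^nat) n :
  -1 < alpha -> (forall k, (1 <= k)%N -> 0 <= a k) ->
  mean_ratio alpha n.+2 * weighted_gmean alpha a n.+1 <=
  (mean_ratio alpha n.+1 - 1) * weighted_gmean alpha a n +
  expR (alpha + 1)^-1 * a n.+1.
Proof.
move=> halpha ha0.
have key := mean_ratioS_le halpha (isT : (0 < n.+1)%N).
have r1 := mean_ratio_ge1 alpha n.
apply: (le_trans (ler_wpM2r (weighted_gmean_ge0 alpha a n.+1) key)).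
rewrite weighted_gmeanS expRM.
move: r1 (weighted_gmean_ge0 alpha a n) (ha0 n.+1 isT).
move: (mean_ratio _ _) (weighted_gmean _ _ n) (a n.+1) => r x y r1 x0 y0.
set C := expR _.
have r0 : 0 < r by lra.
have C0 : 0 <= C by exact: expR_ge0.
have q01 : 0 <= r^-1 <= 1 by rewrite invr_ge0 ltW//= invf_le1.
(* Using [C * y] in place of [y] absorbs the factor [C^(1/r)] left by the growth estimate. *)
have amgm := weighted_amgm2 q01 x0 (mulr_ge0 C0 y0).
rewrite powRM// in amgm.
rewrite -mulrA [C `^ _ * _]mulrCA.
apply: (le_trans (ler_wpM2l (ltW r0) amgm)).
by rewrite le_eqVlt; apply/orP; left; apply/eqP; field; rewrite gt_eqF.
Qed.

Lemma series1_gmean_le (R : realType) (alpha : R) (a : R^nat) N :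
  -1 < alpha -> (forall k, (1 <= k)%N -> 0 <= a k) ->
  series1 (weighted_gmean alpha a) N +
    (mean_ratio alpha N.+1 - 1) * weighted_gmean alpha a N <=
  expR (alpha + 1)^-1 * series1 a N.
Proof.
move=> halpha ha0; elim: N => [|N IH].
  (* The empty mean [G_0] is 1, not 0; its term disappears because [r_1 = 1]. *)
  by rewrite /series1 !big_geq// mean_ratio1 subrr mul0r addr0 mulr0.
rewrite !series1S mulrDr; have := mean_ratio_gmeanS_le N halpha ha0.
lra.
Qed.

Lemma series1_nondecreasing (R : realType) (a : nat -> R) :
  (forall n, (1 <= n)%N -> 0 <= a n) -> nondecreasing_seq (series1 a).
Proof.
by move=> a0; apply/nondecreasing_seqP => n; rewrite series1S lerDl a0.
Qed.

Theorem theorem6p2 (R : realType) (alpha : R) (halpha : -1 < alpha)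
    (a : nat -> R) (ha0 : forall n : nat, (1 <= n)%N -> 0 <= a n)
    (hcvg : cvgn (series1 a)) :
  cvgn (series1 (weighted_gmean alpha a)) /\
  limn (series1 (weighted_gmean alpha a))
    <= expR ((alpha + 1)^-1) * limn (series1 a).
Proof.
have a_nd := series1_nondecreasing ha0.
have G_nd : nondecreasing_seq (series1 (weighted_gmean alpha a)).
  by apply: series1_nondecreasing => n _; exact: weighted_gmean_ge0.
have G_le N : series1 (weighted_gmean alpha a) N <=
    expR ((alpha + 1)^-1) * limn (series1 a).
  apply: le_trans (_ : expR ((alpha + 1)^-1) * series1 a N <= _); last first.
    by rewrite ler_wpM2l ?expR_ge0// nondecreasing_cvgn_le.
  apply: le_trans (series1_gmean_le N halpha ha0).
  rewrite lerDl mulr_ge0 ?weighted_gmean_ge0// subr_ge0.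
  by rewrite mean_ratio_ge1.
have G_cvg : cvgn (series1 (weighted_gmean alpha a)).
  apply: nondecreasing_is_cvgn => //.
  by exists (expR ((alpha + 1)^-1) * limn (series1 a)) => _ [N _ <-].
by split=> //; apply: limr_le => //; exact: nearW.
Qed.
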